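(* Let $P\in\mathbb{R}^{n\times n}$ be any $d$-sparse transition probability matrix and let $\varepsilon>0$. The algorithm S-FW (the Frank--Wolfe algorithm with sparse updates described in the context) requires at most $k=32\,\varepsilon^{-2}$ iterations to guarantee $\|P^\top x-x\|_2\le\varepsilon$. The overall time complexity of the algorithm does not exceed $$T=O\left(n+\frac{d^2\log(2+n/d^2)}{\varepsilon^2}\right).$$
   Context: A transition probability matrix $P\in\mathbb{R}^{n\times n}$ is a matrix with non-negative entries whose rows each sum to $1$ (so a stationary distribution is a probability vector $x$ with $P^\top x=x$). $P$ is $d$-sparse if each row and each column of $P$ contains at most $d$ non-zero entries. The sparsity pattern (underlying graph structure) of $P$ is assumed known a priori. Let $A=P^\top-I$, $f(x)=\frac12\|Ax\|_2^2$, and $\Delta_1^n=\{x\in\mathbb{R}^n:\sum_{i=1}^n x^i=1,\ x^i\ge0\}$. Algorithm S-FW. Start from $x_1$ equal to an arbitrary vertex of $\Delta_1^n$. For $k=1,2,\dots$, until $\|Ax_k\|_2\le\varepsilon$: let $i_k\in\arg\min_{1\le i\le n}\partial f(x_k)/\partial x^i$; let $h_k$ be the $i_k$-th coordinate unit vector (a minimizer of $h^\top\nabla f(x_k)$ over $h\in\Delta_1^n$); set $$x_{k+1}=(1-\gamma_k)x_k+\gamma_k h_k,\qquad \gamma_k=\frac{2}{k+1}.$$ Implementation: $x_k$ is represented implicitly as $x_k=\beta_k z_k$ with a scalar $\beta_k$ (the running product of the factors $1-\gamma_r$) and a vector $z_k$, so that one step is the sparse update $z_{k+1}=z_k+\tilde\gamma_k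 h_k$ with $\tilde\gamma_k=\gamma_k/\beta_{k+1}$; the rescaled gradient $A^\top A z_k$ is updated by adding the sparse vector $\tilde\gamma_k A^\top A h_k$, and the function value is updated analogously. The coordinates of $A^\top A z_k$ are stored in a doubly-linked list of binary min-heaps, obtained by splitting the coordinates into consecutive blocks of about $n/d^2$ coordinates each, from which the minimal coordinate is extracted. The vector $x_k=\beta_k z_k$ is computed explicitly only at the last iteration. Time complexity is the total number of arithmetic operations, including initialization; the constant in $O(\cdot)$ is absolute.
   Formalization: Since γ_1 = 1, the running product β_2 is 0 and the rescaled step γ_1/β_2 is undefined; the implementation here omits the factor r = 1 from the product and carries out the first step by subtracting z_1 and adding h_1 (two sparse updates). The iterates x_k are unchanged. *)

(* Defs.v *)
From HB Require Import structures.
From mathcomp Require Import all_boot all_order all_algebra.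
From mathcomp Require Import all_classical all_reals all_analysis.
Set Implicit Arguments.
Unset Strict Implicit.
Unset Printing Implicit Defensive.
Import Order.TTheory GRing.Theory Num.Theory.
Import numFieldNormedType.Exports.
Local Open Scope ring_scope.

Section Problem.
Variables (R : realType) (n : nat).
Implicit Types (P : 'M[R]_n) (x : 'cV[R]_n).

Definition transition_matrix P :=
  (forall i j, 0 <= P i j) /\ (forall i, \sum_j P i j = 1).

Definition sparse (d : nat) P :=
  (forall i, #|[set j | P i j != 0%R]| <= d)%N /\
  (forall j, #|[set i | P i j != 0%R]| <= d)%N.

(* The norm that MathComp-Analysis puts on matrices is the max norm. *)
Definition l2norm x : R := Num.sqrt (\sum_i x i 0 ^+ 2).

Definition Amx P : 'M[R]_n := P^T - 1%:M.

Definition objective P x : R := 2^-1 * l2norm (Amx P *m x) ^+ 2.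

Definition unitv (i : 'I_n) : 'cV[R]_n := delta_mx i 0.

Definition partial (f : 'cV[R]_n -> R) (i : 'I_n) x : R := 'D_(unitv i) f x.

Definition argmin_partial (f : 'cV[R]_n -> R) x (i : 'I_n) :=
  forall j, partial f i x <= partial f j x.

Definition gamma (k : nat) : R := 2 / k.+1%:R.

(* x_1, x_2, ... are the iterates of S-FW without its stopping test, for an
   arbitrary initial vertex and arbitrary choices in the arg min; x 0 is
   unused. *)
Definition SFW_sequence P (x : nat -> 'cV[R]_n) :=
  (exists i, x 1%N = unitv i) /\
  (forall k, (1 <= k)%N -> exists2 i, argmin_partial (objective P) (x k) i &
     x k.+1 = (1 - gamma k) *: x k + gamma k *: unitv i).

(* S-FW with tolerance eps stops on x after exactly T iterations (T updates),
   that is, at x_(T+1). *)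
Definition stops_after P (eps : R) (x : nat -> 'cV[R]_n) (T : nat) :=
  l2norm (Amx P *m x T.+1) <= eps /\
  (forall k, (1 <= k <= T)%N -> eps < l2norm (Amx P *m x k)).

End Problem.

(* The implementation of S-FW, as a program in a state-and-cost monad over the
   memory of a real RAM. Every arithmetic operation or comparison on reals and
   on indices ([op], always applied to a single operation), every access to an
   entry of P, every memory access and every step of a list traversal has cost
   1. *)

Record memory (R : Type) (n : nat) := Memory {
  mem_z : 'I_n -> R;
  mem_g : 'I_n -> R;             (* A^T A z, which is also the heap key *)
  mem_heap : nat -> 'I_n;        (* slot |-> coordinate *)
  mem_pos : 'I_n -> nat;         (* coordinate |-> slot *)
  mem_next : nat -> option nat;  (* links of the doubly-linked list of heaps *)
  mem_prev : nat -> option nat;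
  mem_out : 'I_n -> R }.

Definition upd (I : eqType) (T : Type) (f : I -> T) (i : I) (v : T) : I -> T :=
  fun j => if j == i then v else f j.

Definition comp (R : Type) (n : nat) (T : Type) :=
  memory R n -> T * memory R n * nat.

Section Monad.
Variables (R : Type) (n : nat).
Implicit Types (m : memory R n).

Definition ret (T : Type) (v : T) : comp R n T := fun m => (v, m, 0%N).

Definition bind (T U : Type) (c : comp R n T) (f : T -> comp R n U) :
    comp R n U :=
  fun m => let: (v, m1, t1) := c m in
           let: (w, m2, t2) := f v m1 in (w, m2, (t1 + t2)%N).

Definition op (T : Type) (v : T) : comp R n T := fun m => (v, m, 1%N).

Definition get_z i : comp R n R := fun m => (mem_z m i, m, 1%N).
Definition get_g i : comp R n R := fun m => (mem_g m i, m, 1%N).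
Definition get_heap s : comp R n 'I_n := fun m => (mem_heap m s, m, 1%N).
Definition get_pos i : comp R n nat := fun m => (mem_pos m i, m, 1%N).
Definition get_next b : comp R n (option nat) := fun m => (mem_next m b, m, 1%N).

Definition set_z i v : comp R n unit := fun m =>
  (tt, Memory (upd (mem_z m) i v) (mem_g m) (mem_heap m) (mem_pos m)
              (mem_next m) (mem_prev m) (mem_out m), 1%N).
Definition set_g i v : comp R n unit := fun m =>
  (tt, Memory (mem_z m) (upd (mem_g m) i v) (mem_heap m) (mem_pos m)
              (mem_next m) (mem_prev m) (mem_out m), 1%N).
Definition set_heap s i : comp R n unit := fun m =>
  (tt, Memory (mem_z m) (mem_g m) (upd (mem_heap m) s i) (mem_pos m)
              (mem_next m) (mem_prev m) (mem_out m), 1%N).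
Definition set_pos i s : comp R n unit := fun m =>
  (tt, Memory (mem_z m) (mem_g m) (mem_heap m) (upd (mem_pos m) i s)
              (mem_next m) (mem_prev m) (mem_out m), 1%N).
Definition set_next b v : comp R n unit := fun m =>
  (tt, Memory (mem_z m) (mem_g m) (mem_heap m) (mem_pos m)
              (upd (mem_next m) b v) (mem_prev m) (mem_out m), 1%N).
Definition set_prev b v : comp R n unit := fun m =>
  (tt, Memory (mem_z m) (mem_g m) (mem_heap m) (mem_pos m)
              (mem_next m) (upd (mem_prev m) b v) (mem_out m), 1%N).
Definition set_out i v : comp R n unit := fun m =>
  (tt, Memory (mem_z m) (mem_g m) (mem_heap m) (mem_pos m)
              (mem_next m) (mem_prev m) (upd (mem_out m) i v), 1%N).

Fixpoint fold_list (T U : Type) (body : U -> T -> comp R n U) (u : U)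
    (s : seq T) : comp R n U :=
  if s is t :: s' then
    bind (op tt) (fun _ => bind (body u t) (fun v => fold_list body v s'))
  else ret u.

Definition for_each (T : Type) (s : seq T) (body : T -> comp R n unit) :
    comp R n unit :=
  fold_list (fun _ t => body t) tt s.

End Monad.

Arguments ret {R n T} v.
Arguments op {R n T} v.

Notation "'let*' x := c 'in' e" := (bind c (fun x => e))
  (at level 200, x binder, c at level 200, e at level 200,
   format "'let*'  x  :=  c  'in' '//' e").

Section Implementation.
Variables (R : realType) (n : nat) (P : 'M[R]_n) (d : nat) (eps : R).
Variable i0 : 'I_n.
Local Notation comp := (@comp R n).

(* The sparsity pattern of P with the diagonal added, which contains that of
   A = P^T - I. It is known a priori, so only its traversal is charged. *)
Definition pattern_col (i : 'I_n) : seq 'I_n :=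
  [seq j <- enum 'I_n | (P i j != 0) || (j == i)].
Definition pattern_row (j : 'I_n) : seq 'I_n :=
  [seq l <- enum 'I_n | (P l j != 0) || (l == j)].

(* The entry of A in row j and column i. *)
Definition entryA (j i : 'I_n) : comp R :=
  let* p := op (P i j) in
  let* b := op (i == j) in
  if b then op (p - 1) else ret p.

(* Two constants of the run, whose O(1) computation is not charged.
   ceil (n / d ^ 2) coordinates per heap (for n > 0 and d > 0); the heap number
   b occupies the slots b * block_size, ..., min ((b + 1) * block_size, n) - 1,
   its root coming first and the children of the slot at offset r being at
   offsets 2 r + 1 and 2 r + 2. *)
Definition block_size : nat := (n.-1 %/ (d ^ 2)).+1%N.
Definition num_blocks : nat := (n.-1 %/ block_size).+1.

Definition swap (p q : nat) : comp unit :=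
  let* i := get_heap p in
  let* j := get_heap q in
  let* _ := set_heap p j in
  let* _ := set_heap q i in
  let* _ := set_pos j p in
  set_pos i q.

(* In the loops below, [fuel] only makes the recursion structural: it is
   always large enough for the loop to end by its own exit test. *)

Fixpoint sift_up (fuel base p : nat) : comp unit :=
  if fuel is fuel'.+1 then
    let* at_root := op (p == base) in
    if at_root then ret tt else
    let* r := op (p - base)%N in
    let* r1 := op (r.-1) in
    let* h := op (r1 %/ 2)%N in
    let* q := op (base + h)%N in
    let* i := get_heap p in
    let* j := get_heap q in
    let* gi := get_g i in
    let* gj := get_g j in
    let* lt := op (gi < gj) in
    if lt then
      let* _ := swap p q in
      sift_up fuel' base q
    else ret tt
  else ret tt.

Fixpoint sift_down (fuel base stop p : nat) : comp unit :=
  if fuel is fuel'.+1 then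
    let* r := op (p - base)%N in
    let* r2 := op (2 * r)%N in
    let* b1 := op (base + r2)%N in
    let* q1 := op (b1 + 1)%N in
    let* has1 := op (q1 < stop)%N in
    if ~~ has1 then ret tt else
    let* i1 := get_heap q1 in
    let* g1 := get_g i1 in
    let* q2 := op (q1 + 1)%N in
    let* has2 := op (q2 < stop)%N in
    let* child :=
      (if has2 then
         let* i2 := get_heap q2 in
         let* g2 := get_g i2 in
         let* lt := op (g2 < g1) in
         ret (if lt then (q2, g2) else (q1, g1))
       else ret (q1, g1)) in
    let* i := get_heap p in
    let* gi := get_g i in
    let* lt := op (child.2 < gi) in
    if lt then
      let* _ := swap p child.1 in
      sift_down fuel' base stop child.1
    else ret tt
  else ret tt.

Definition add_key (l : 'I_n) (delta : R) : comp unit :=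
  let* g := get_g l in
  let* g' := op (g + delta) in
  let* _ := set_g l g' in
  let* p := get_pos l in
  let* b := op (p %/ block_size)%N in
  let* base := op (b * block_size)%N in
  let* decreased := op (delta <= 0) in
  if decreased then sift_up block_size base p
  else
    let* e := op (base + block_size)%N in
    let* stop := op (minn e n) in
    sift_down block_size base stop p.

Fixpoint min_from (fuel b : nat) (best : 'I_n * R) : comp 'I_n :=
  if fuel is fuel'.+1 then
    let* next := get_next b in
    if next is Some b' then
      let* s := op (b' * block_size)%N in
      let* i := get_heap s in
      let* g := get_g i in
      let* lt := op (g < best.2) in
      min_from fuel' b' (if lt then (i, g) else best)
    else ret best.1
  else ret best.1.

Definition min_coordinate : comp 'I_n :=
  let* i := get_heap 0%N in
  let* g := get_g i in
  min_from num_blocks 0%N (i, g).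

(* || A h ||_2^2, for h the i-th unit vector. *)
Definition sqnorm_col (i : 'I_n) : comp R :=
  fold_list (fun acc j =>
    let* a := entryA j i in
    let* a2 := op (a * a) in
    op (acc + a2)) 0 (pattern_col i).

(* Adds c A^T A h to the rescaled gradient, for h the i-th unit vector. *)
Definition add_gradient (i : 'I_n) (c : R) : comp unit :=
  for_each (pattern_col i) (fun j =>
    let* a := entryA j i in
    let* w := op (c * a) in
    for_each (pattern_row j) (fun l =>
      let* b := entryA j l in
      let* delta := op (w * b) in
      add_key l delta)).

(* z := z + c h, for h the i-th unit vector; F is f(z), and the result is the
   new value of f(z), by
   f(z + c h) = f(z) + c h^T A^T A z + (c^2 / 2) || A h ||_2^2. *)
Definition sparse_update (F : R) (i : 'I_n) (c : R) : comp R :=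
  let* z := get_z i in
  let* z' := op (z + c) in
  let* _ := set_z i z' in
  let* g := get_g i in
  let* t1 := op (c * g) in
  let* q := sqnorm_col i in
  let* c2 := op (c * c) in
  let* c2q := op (c2 * q) in
  let* t2 := op (c2q / 2) in
  let* F1 := op (F + t1) in
  let* F2 := op (F1 + t2) in
  let* _ := add_gradient i c in
  ret F2.

(* || A x ||_2 <= eps for x = beta z, tested on squares, with F = f(z). *)
Definition stop_test (beta F : R) : comp bool :=
  let* b2 := op (beta * beta) in
  let* fx := op (b2 * F) in
  let* nx := op (2 * fx) in
  let* e2 := op (eps * eps) in
  op (nx <= e2).

(* Iteration number k. As gamma_1 = 1, the first iteration forgets x_1: its
   factor 1 - gamma_1 = 0 is left out of the product beta (which stays 1), and
   z_1 = h_(i0) is subtracted from z instead. *)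
Definition iteration (k : nat) (beta F : R) : comp (R * R) :=
  let* i := min_coordinate in
  let* first := op (k == 1)%N in
  if first then
    let* F1 := sparse_update F i0 (- 1) in
    let* F2 := sparse_update F1 i 1 in
    ret (beta, F2)
  else
    let* k1 := op k.+1 in
    let* kr := op (k1%:R : R) in
    let* gam := op (2 / kr) in
    let* fac := op (1 - gam) in
    let* beta' := op (beta * fac) in
    let* c := op (gam / beta') in
    let* F' := sparse_update F i c in
    ret (beta', F').

(* Runs from iterate number k; the result is the final k and beta, or None
   when the stopping test has not succeeded within [fuel] iterations. *)
Fixpoint main_loop (fuel k : nat) (beta F : R) : comp (option (nat * R)) :=
  let* stop := stop_test beta F in
  if stop then ret (Some (k, beta)) else
  if fuel is fuel'.+1 then
    let* st := iteration k beta F in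
    let* k' := op k.+1 in
    main_loop fuel' k' st.1 st.2
  else ret None.

Definition init_z : comp unit :=
  let* _ := for_each (enum 'I_n) (fun i => set_z i 0) in
  set_z i0 1.

(* For the zero gradient, any arrangement of the coordinates is a heap. *)
Definition init_heaps : comp unit :=
  let* _ := for_each (enum 'I_n) (fun i =>
    let* _ := set_g i 0 in
    let* _ := set_heap i i in
    set_pos i i) in
  for_each (iota 0 num_blocks) (fun b =>
    let* b' := op b.+1 in
    let* more := op (b' < num_blocks)%N in
    let* _ := set_next b (if more then Some b' else None) in
    let* at_head := op (b == 0)%N in
    if at_head then set_prev b None else
    let* p := op b.-1 in
    set_prev b (Some p)).

Definition output (beta : R) : comp unit :=
  for_each (enum 'I_n) (fun i =>
    let* z := get_z i in
    let* v := op (beta * z) in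
    set_out i v).

(* The result is the number T of iterations performed, the computed vector
   being then in [mem_out]; None means that [fuel] iterations are not enough.
   The gradient and the heaps are only set up if x_1 is not returned at once. *)
Definition sfw (fuel : nat) : comp (option nat) :=
  let* _ := init_z in
  let* q := sqnorm_col i0 in
  let* F := op (q / 2) in
  let* stop := stop_test 1 F in
  if stop then
    let* _ := output 1 in
    ret (Some 0%N)
  else
    let* _ := init_heaps in
    let* _ := add_gradient i0 1 in
    let* r := main_loop fuel 1 1 F in
    if r is Some (k, beta) then
      let* _ := output beta in
      let* T := op k.-1 in
      ret (Some T)
    else ret None.

End Implementation.

Definition time_bound (R : realType) (n d : nat) (eps : R) : R :=
  n%:R + d%:R ^+ 2 * ln (2 + n%:R / d%:R ^+ 2) / eps ^+ 2.

(* Main.v *)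
Require Import Defs.
From HB Require Import structures.
From mathcomp Require Import all_boot all_order all_algebra.
From mathcomp Require Import all_classical all_reals all_analysis.
From mathcomp Require Import zify ring lra.
Set Implicit Arguments.
Unset Strict Implicit.
Unset Printing Implicit Defensive.
Import Order.TTheory GRing.Theory Num.Theory.
Import numFieldNormedType.Exports.
Local Open Scope ring_scope.

(** Why the theorem holds. Write A = P^T - I and N_k = |A x_k|^2. The update
    x_(k+1) = (1 - g) x_k + g h, with h the unit vector of the chosen coordinate
    i, gives
      N_(k+1) = (1 - g)^2 N_k + 2 g (1 - g) (A^T A x_k)_i + g^2 |A h|^2.
    The middle term is nonpositive ([grad_argmin_le0]): at a coordinate j where
    w = A x_k is largest, (A^T w)_j is an average of the entries of w (weighted
    by row j of P) minus the largest one, and the coordinate i does at least as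
    well as j. Moreover |A h|^2 <= 2. With g = 2 / (k + 1), induction on k gives
    N_k <= 4 / k ([SFW_rate]), so that the stopping test succeeds after at most
    32 / eps^2 iterations ([SFW_stops]).

    Running time. Programs are analysed with a weakest precondition [wp] which
    carries a budget of elementary operations, so that correctness and cost are
    proved by the same induction. After one key has changed, a sift restores
    the heap order along a single path of the heap tree ([wp_sift_up],
    [wp_sift_down]); if a block has fewer than 2^h slots this takes O(h)
    operations. A column and a row of A have at most d + 1 nonzero entries, so a
    gradient update changes O(d^2) keys ([wp_add_gradient]), while the minimum
    is found among the roots of at most d^2 heaps ([wp_min_coordinate]). An
    iteration therefore costs O(d^2 h), and h = O(log (2 + n / d^2)) because a
    block has at most 1 + n / d^2 slots ([block_size_depth]). The loop runs
    T <= 32 / eps^2 times; the cost of the set-up is linear in n, plus one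
    gradient update, and the latter is paid for by 1 / eps^2 since the set-up is
    made only if eps^2 < |A x_1|^2 <= 2 ([cost_bound]).

    The theorem asks for an infinite sequence of iterates although the program
    stops. It is read off the run of the loop body without its stopping test
    ([run], [run_SFW]), which the actual program follows up to the first success
    of the test ([wp_main_loop]). *)

(** * Convergence of the Frank-Wolfe iteration *)

Section Convergence.
Local Open Scope classical_set_scope.
Variables (R : realType) (n : nat) (P : 'M[R]_n).
Implicit Types (x u v w : 'cV[R]_n) (i j l : 'I_n).

Definition dot u v : R := \sum_j u j 0 * v j 0.

Definition grad x : 'cV[R]_n := (Amx P)^T *m (Amx P *m x).

Lemma l2norm_sqr u : l2norm u ^+ 2 = dot u u.
Proof.
rewrite sqr_sqrtr; first by apply: eq_bigr => j _; rewrite expr2.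
by apply: sumr_ge0 => j _; exact: sqr_ge0.
Qed.

Lemma dot_ge0 u : 0 <= dot u u.
Proof. by apply: sumr_ge0 => j _; rewrite -expr2 sqr_ge0. Qed.

Lemma l2norm_le u (e : R) : 0 < e -> (l2norm u <= e) = (dot u u <= e * e).
Proof.
move=> e0; rewrite -l2norm_sqr -expr2 ler_sqr ?nnegrE ?sqrtr_ge0 //.
exact: ltW.
Qed.

Lemma dot_comb (a b : R) u v :
  dot (a *: u + b *: v) (a *: u + b *: v) =
  a ^+ 2 * dot u u + 2 * (a * b) * dot u v + b ^+ 2 * dot v v.
Proof.
rewrite /dot !mulr_sumr -!big_split /=; apply: eq_bigr => j _.
by rewrite !mxE; ring.
Qed.

Lemma Amx_unitv i j : (Amx P *m unitv R i) j 0 = Amx P j i.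
Proof.
rewrite mxE (bigD1 i) //= big1 ?addr0 => [|l ne_li].
  by rewrite [unitv R i _ _]mxE !eqxx mulr1.
by rewrite [unitv R i _ _]mxE (negbTE ne_li) mulr0.
Qed.

Lemma AmxE j i : Amx P j i = P i j - (i == j)%:R.
Proof. by rewrite /Amx !mxE eq_sym. Qed.

Lemma gradE x i : grad x i 0 = dot (Amx P *m x) (Amx P *m unitv R i).
Proof.
rewrite mxE; apply: eq_bigr => j _.
by rewrite Amx_unitv mxE mulrC.
Qed.

Lemma gradZ (a : R) x i : grad (a *: x) i 0 = a * grad x i 0.
Proof. by rewrite /grad -!scalemxAr mxE. Qed.

Lemma objectiveE x : objective P x = 2^-1 * dot (Amx P *m x) (Amx P *m x).
Proof. by rewrite /objective l2norm_sqr. Qed.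

(** The objective is quadratic, so this expansion is exact. It yields both the
    partial derivatives and the incremental update of the function value. *)
Lemma objective_shift x i (c : R) :
  objective P (x + c *: unitv R i) =
  objective P x + c * grad x i 0 +
  c * c * dot (Amx P *m unitv R i) (Amx P *m unitv R i) / 2.
Proof.
rewrite !objectiveE gradE mulmxDr -scalemxAr -[Amx P *m x in LHS]scale1r.
by rewrite dot_comb; field.
Qed.

Lemma partial_objective i x : partial (objective P) i x = grad x i 0.
Proof.
rewrite /partial /derive; apply: cvg_lim => //.
set q := dot (Amx P *m unitv R i) (Amx P *m unitv R i) / 2.
have lim0 : (fun h : R => grad x i 0 + h * q) @ 0^' --> grad x i 0.
  rewrite -[X in _ --> X]addr0 -[X in _ + X](mul0r q).
  apply: cvgD; first exact: cvg_cst.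
  by apply: cvgM; [exact: cvg_within | exact: cvg_cst].
apply: cvg_trans lim0; apply: near_eq_cvg.
near=> h.
have h0 : h != 0 by near: h; exact: nbhs_dnbhs_neq.
rewrite /= [_ + x]addrC objective_shift /q /GRing.scale /=.
by field.
Unshelve. all: by end_near.
Qed.

Lemma argmin_partial_grad x i :
  argmin_partial (objective P) x i <-> forall j, grad x i 0 <= grad x j 0.
Proof. by split=> H j; have := H j; rewrite !partial_objective. Qed.

Hypothesis trP : transition_matrix P.

Lemma transition_le1 i j : P i j <= 1.
Proof.
case: trP => P0 P1; rewrite -(P1 i) (bigD1 j) //= lerDl.
by apply: sumr_ge0.
Qed.

(** Column i of A is row i of P minus a unit vector. As the entries of P lie in
    [0, 1], (p - e)^2 <= p + e for e = 0 or 1, and both terms sum to 1. *)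
Lemma dot_unitv_le2 i : dot (Amx P *m unitv R i) (Amx P *m unitv R i) <= 2.
Proof.
case: (trP) => P0 P1.
suff bound : dot (Amx P *m unitv R i) (Amx P *m unitv R i)
    <= \sum_j (P i j + (i == j)%:R).
  apply: le_trans bound _; rewrite big_split /= P1.
  rewrite (bigD1 i) //= eqxx big1 ?addr0 // => j ne_ji.
  by rewrite eq_sym (negbTE ne_ji).
apply: ler_sum => j _; rewrite Amx_unitv AmxE.
have := P0 i j; have := transition_le1 i j.
by case: (i == j) => /=; nra.
Qed.

(** It suffices to find one coordinate of A^T w, w = A x, which is nonpositive:
    a maximizer of w is one, since row j of P averages the entries of w. *)
Lemma grad_argmin_le0 x i :
  (forall j, grad x i 0 <= grad x j 0) -> grad x i 0 <= 0.
Proof.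
case: (trP) => P0 P1 min_i.
pose w := Amx P *m x.
have [j _ max_j] := @Order.TotalTheory.arg_maxP _ R _ i xpredT
  (fun l => w l 0) isT.
apply: le_trans (min_i j) _; rewrite /grad -/w mxE.
rewrite (eq_bigr (fun l => P j l * w l 0 - (j == l)%:R * w l 0)); last first.
  by move=> l _; rewrite mxE AmxE mulrBl.
rewrite sumrB [X in _ - X](bigD1 j) //= eqxx mul1r [X in _ - (_ + X)]big1.
  rewrite addr0 subr_le0 -[leRHS]mul1r -(P1 j) mulr_suml.
  by apply: ler_sum => l _; apply: ler_wpM2l => //; exact: max_j.
by move=> l ne_lj; rewrite eq_sym (negbTE ne_lj) mul0r.
Qed.

(** With a = k and g = 2 / (a + 2), the induction step amounts to
    a^2 N + 4 q <= 4 (a + 2) where N <= 4 / (a + 1) and q <= 2, the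
    cross term being dropped; at k = 0 the bound is that of a vertex. *)
Lemma SFW_rate (x : nat -> 'cV[R]_n) k :
  SFW_sequence P x ->
  dot (Amx P *m x k.+1) (Amx P *m x k.+1) <= 4 / k.+1%:R.
Proof.
case=> -[i1 x1] step; elim: k => [|k IHk].
  by rewrite x1 divr1; apply: le_trans (dot_unitv_le2 i1) _; lra.
have [//|i /argmin_partial_grad min_i ->] := step k.+1.
rewrite mulmxDr -!scalemxAr dot_comb -gradE.
move: (grad (x k.+1) i 0) (grad_argmin_le0 min_i) => g gi0.
have := dot_unitv_le2 i; have := dot_ge0 (Amx P *m unitv R i).
move: (dot (Amx P *m unitv R i) _) => q q0 q2.
move: (dot _ _) IHk (dot_ge0 (Amx P *m x k.+1)) => N IHk N0.
clear x step i1 x1 i min_i.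
have k0 : 0 <= k%:R :> R by [].
have Ek : k.+1%:R = k%:R + 1 :> R by rewrite natr1.
have Ek2 : k.+2%:R = k%:R + 2 :> R by rewrite -natr1 Ek; lra.
move: IHk; rewrite /gamma Ek Ek2 => IHk; move: (k%:R : R) k0 IHk => a a0.
rewrite ler_pdivlMr; last by lra.
move=> IHk.
have -> : 1 - 2 / (a + 2) = a / (a + 2) by field; lra.
rewrite ler_pdivlMr; last by lra.
have -> : ((a / (a + 2)) ^+ 2 * N + 2 * (a / (a + 2) * (2 / (a + 2))) * g +
    (2 / (a + 2)) ^+ 2 * q) * (a + 2) =
   (a ^+ 2 * N + 4 * a * g + 4 * q) / (a + 2) by field; lra.
rewrite ler_pdivrMr; last by lra.
have : a * g <= 0 by nra.
have : a * (N * (a + 1)) <= a * 4 by nra.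
have : 0 <= a * N by nra.
nra.
Qed.

Lemma SFW_stops (eps : R) (x : nat -> 'cV[R]_n) :
  0 < eps -> SFW_sequence P x ->
  exists2 T, stops_after P eps x T & T%:R <= 32 * eps ^- 2.
Proof.
move=> e0 Sx; have e2 : 0 < eps ^- 2 by rewrite invr_gt0 exprn_gt0.
pose stop k := l2norm (Amx P *m x k.+1) <= eps.
pose K := Num.truncn (32 * eps ^- 2).
have KE : 32 * eps ^- 2 < K.+1%:R.
  by apply: truncnS_gt; lra.
have stopK : stop K.
  rewrite /stop l2norm_le // -expr2; apply: le_trans (SFW_rate K Sx) _.
  rewrite ler_pdivrMr; last by [].
  have e20 : 0 < eps ^+ 2 by rewrite exprn_gt0.
  have := ltW KE; rewrite -(ler_pM2l e20) mulrCA mulfV ?gt_eqF // mulr1; lra.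
have [T stopT minT] := ex_minnP (ex_intro stop K stopK).
exists T.
  split=> // k /andP[k0 kT]; rewrite ltNge; apply/negP => stop_k.
  by have := minT k.-1; rewrite /stop prednK // => /(_ stop_k); lia.
apply: le_trans (_ : K%:R <= _); first by rewrite ler_nat minT.
by rewrite /K truncn_le; lra.
Qed.

End Convergence.

(** * Budgeted preconditions and the binary heaps *)

Section Heaps.
Variables (R : realType) (n d : nat).
Implicit Types (m : memory R n) (i j l : 'I_n) (p q s r b h : nat).
Local Notation prog := (@Defs.comp R n).
Local Notation bs := (block_size n d).

(** The cost is bounded by a budget instead of being computed, so that branches
    and loop bodies of different costs can share one postcondition. *)
Definition wp (T : Type) (c : prog T) m (t : nat)
    (Q : T -> memory R n -> Prop) : Prop :=
  let: (v, m', t') := c m in (t' <= t)%N /\ Q v m'.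

Lemma wp_ret (T : Type) (v : T) m t (Q : T -> memory R n -> Prop) :
  Q v m -> wp (ret v) m t Q.
Proof. by []. Qed.

Lemma wp_bind (T U : Type) t1 t2 (c : prog T) (f : T -> prog U) m t Q :
  (t1 + t2 <= t)%N -> wp c m t1 (fun v m' => wp (f v) m' t2 Q) ->
  wp (bind c f) m t Q.
Proof.
rewrite /wp /bind => tle; case: (c m) => -[v m'] t1' [le1].
by case: (f v m') => -[w m''] t2' [le2 Qw]; split=> //; lia.
Qed.

Lemma wp_weaken (T : Type) t1 (Q1 : T -> memory R n -> Prop) (c : prog T) m t Q :
  wp c m t1 Q1 -> (t1 <= t)%N -> (forall v m', Q1 v m' -> Q v m') ->
  wp c m t Q.
Proof.
rewrite /wp; case: (c m) => -[v m'] t' [le1 Q1v] le2 imp.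
by split; [lia | exact: imp].
Qed.

Lemma wp_leq (T : Type) t1 (c : prog T) m t Q :
  (t1 <= t)%N -> wp c m t1 Q -> wp c m t Q.
Proof. by move=> le_t H; apply: wp_weaken H le_t _. Qed.

(** The budget is kept in the form numeral + remainder, so that the rule applies
    by unification and each elementary operation takes 1 off the numeral. *)
Lemma wp_step (T U : Type) (k : nat) (v : T) m' (c : prog T) (f : T -> prog U)
    m t Q :
  c m = (v, m', 1%N) -> wp (f v) m' (k + t) Q ->
  wp (bind c f) m (k.+1 + t) Q.
Proof.
move=> cE H; apply: (@wp_bind _ _ 1 (k + t)); first by rewrite addSn.
by rewrite /wp cE.
Qed.

Lemma wp_last (T : Type) (k : nat) (v : T) m' (c : prog T) m t
    (Q : T -> memory R n -> Prop) :
  c m = (v, m', 1%N) -> Q v m' -> wp c m (k.+1 + t) Q.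
Proof. by rewrite /wp => ->. Qed.

(** The invariant speaks of the part of the list which is still to be
    traversed. *)
Lemma wp_fold_list (T U : Type) (inv : seq T -> U -> memory R n -> Prop)
    (k : nat) (body : U -> T -> prog U) (xs : seq T) (u : U) m (t : nat)
    (Q : U -> memory R n -> Prop) :
  (forall x (xs' : seq T) v m1, inv (x :: xs') v m1 ->
     wp (body v x) m1 k (fun w m2 => inv xs' w m2)) ->
  ((k.+1) * size xs <= t)%N -> inv xs u m ->
  (forall w m1, inv [::] w m1 -> Q w m1) ->
  wp (fold_list body u xs) m t Q.
Proof.
move=> bodyP; elim: xs u m t => [|x xs IHs] u m t /= tle inv0 QP.
  by apply: wp_ret; exact: QP.
apply: (@wp_leq _ (1 + (k + k.+1 * size xs))); first by lia.
apply: wp_step; first by [].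
apply: (@wp_bind _ _ k (k.+1 * size xs)); first by lia.
apply: wp_weaken (bodyP _ _ _ _ inv0) _ _ => // w m' inv'.
exact: IHs.
Qed.

(** Slots are handled by their absolute number; the block of a slot starts at
    s - s %% bs, and s %% bs is the offset in the binary tree of the block. *)
Definition hroot s := (s %% bs == 0)%N.

Definition hparent s := (s - s %% bs + (s %% bs).-1 %/ 2)%N.

Definition key m s : R := mem_g m (mem_heap m s).

(** Only the slots below n matter: the others keep the arbitrary contents of the
    initial memory. *)
Definition slots_indexed m :=
  (forall s, s < n -> mem_pos m (mem_heap m s) = s)%N /\
  (forall i, mem_pos m i < n /\ mem_heap m (mem_pos m i) = i)%N.

Definition heap_ordered m :=
  forall s, (s < n)%N -> ~~ hroot s -> key m (hparent s) <= key m s.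

Definition same_but_heaps m m' :=
  [/\ mem_z m' = mem_z m, mem_g m' = mem_g m, Defs.mem_next m' = Defs.mem_next m,
      Defs.mem_prev m' = Defs.mem_prev m & mem_out m' = mem_out m].

Lemma same_but_heaps_trans m1 m2 m3 :
  same_but_heaps m1 m2 -> same_but_heaps m2 m3 -> same_but_heaps m1 m3.
Proof. by move=> [? ? ? ? ?] [? ? ? ? ?]; split; congruence. Qed.

Lemma slot_mod_lt s : (s %% bs < bs)%N. Proof. by rewrite ltn_mod. Qed.

Lemma hparent_lt s : ~~ hroot s -> (hparent s < s)%N.
Proof.
rewrite /hroot /hparent -lt0n; have := leq_mod s bs.
move: (s %% bs)%N => r; lia.
Qed.

Lemma mod_shift s r : (r < bs)%N -> ((s - s %% bs + r) %% bs)%N = r.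
Proof.
move=> rb; rewrite {1}(divn_eq s bs) addnK modnMDl.
exact: modn_small.
Qed.

Lemma hparent_mod s : ~~ hroot s -> (hparent s %% bs = (s %% bs).-1 %/ 2)%N.
Proof.
rewrite /hroot -lt0n => r0; rewrite mod_shift //.
by have := slot_mod_lt s; move: (s %% bs)%N r0 => r; lia.
Qed.

Lemma hparent_base s : ~~ hroot s ->
  (hparent s - hparent s %% bs = s - s %% bs)%N.
Proof. by move=> nr; rewrite hparent_mod // /hparent addnK. Qed.

Lemma hchild s p : ~~ hroot s -> hparent s = p ->
  [/\ s = p - p %% bs + 2 * (p %% bs) + 1 \/ s = p - p %% bs + 2 * (p %% bs) + 2 &
      s < p - p %% bs + bs]%N.
Proof.
move=> nr <-; rewrite hparent_base // hparent_mod //.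
move: nr; rewrite /hroot -lt0n.
have := slot_mod_lt s; have := leq_mod s bs; move: (s %% bs)%N => r.
by move=> ? ? ?; split; lia.
Qed.

Lemma is_hchild p e : (0 < e <= 2)%N ->
  let c := (p - p %% bs + 2 * (p %% bs) + e)%N in
  (c < p - p %% bs + bs)%N ->
  [/\ ~~ hroot c, hparent c = p, c %% bs = 2 * (p %% bs) + e &
      c - c %% bs = p - p %% bs]%N.
Proof.
move=> e12 c cb; have rb : (2 * (p %% bs) + e < bs)%N by lia.
have cE : (c %% bs = 2 * (p %% bs) + e)%N by rewrite /c -addnA mod_shift.
split=> //; first by rewrite /hroot cE; lia.
- rewrite /hparent cE /c; have := leq_mod p bs.
  by move: (p %% bs)%N => r; lia.
- by rewrite cE /c; lia.
Qed.

Lemma wp_swap p q m t Q :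
  slots_indexed m -> (p < n)%N -> (q < n)%N -> p != q -> (6 <= t)%N ->
  (forall m', slots_indexed m' -> same_but_heaps m m' ->
     (forall s, key m' s =
        if s == q then key m p else if s == p then key m q else key m s) ->
     Q tt m') ->
  wp (swap p q) m t Q.
Proof.
move=> [hp ph] pn qn ne_pq t6 QP; rewrite /swap.
apply: (@wp_leq _ (6 + 0)) => //.
do 5![apply: wp_step; first by []].
apply: wp_last; first by [].
apply: QP; last by move=> s; rewrite /key /= /upd; case: eqP => // _; case: eqP.
  split=> /= [s sn | i]; rewrite /upd.
    case: (eqVneq s q) => [->|ne_sq]; first by rewrite eqxx.
    case: (eqVneq s p) => [->|ne_sp].
      by rewrite eqxx; case: eqP => // /(congr1 (mem_pos m)); rewrite !hp //; lia.
    case: eqP => [/(congr1 (mem_pos m))|_]; first by rewrite !hp //; lia.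
    case: eqP => [/(congr1 (mem_pos m))|_]; first by rewrite !hp //; lia.
    exact: hp.
  have [pin hpi] := ph i.
  case: (eqVneq i (mem_heap m p)) => [->|ne_ip]; first by rewrite eqxx.
  case: (eqVneq i (mem_heap m q)) => [->|ne_iq].
    by rewrite (negbTE ne_pq) eqxx.
  split=> //; case: eqP => [E|_]; first by rewrite -E hpi eqxx in ne_iq.
  by case: eqP => [E|_]; first by rewrite -E hpi eqxx in ne_ip.
by [].
Qed.

(** The heap order may fail only between p and its parent, the children of p
    being already above the parent of p; swapping moves this defect one level
    up. The exponent h bounds the number of levels above p, because offset + 1
    is at least halved at each step. *)
Lemma wp_sift_up h fuel base p m t (Q : unit -> memory R n -> Prop) :
  (p < n)%N -> base = (p - p %% bs)%N -> (p %% bs < fuel)%N ->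
  (p %% bs + 1 < 2 ^ h)%N -> (20 * h <= t)%N -> slots_indexed m ->
  (forall s, (s < n)%N -> ~~ hroot s -> s != p ->
     key m (hparent s) <= key m s) ->
  (forall s, (s < n)%N -> ~~ hroot s -> ~~ hroot p -> hparent s = p ->
     key m (hparent p) <= key m s) ->
  (forall m', slots_indexed m' -> heap_ordered m' -> same_but_heaps m m' -> Q tt m') ->
  wp (sift_up fuel base p) m t Q.
Proof.
elim: fuel h p m t => [|fuel IH] [|h] p m t //.
  by rewrite expn0; lia.
move=> pn baseE pfuel rl tl idx ord1 ord2 QP /=.
have rb := leq_mod p bs.
apply: (@wp_leq _ (20 + 20 * h)); first by rewrite mulnS in tl.
apply: wp_step; first by [].
case: eqP => [p_root | /eqP p_nroot].
  apply: wp_ret; apply: QP => // s sn nr; apply: ord1 => //.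
  by apply: contra nr => /eqP ->; rewrite /hroot; lia.
have nrp : ~~ hroot p by rewrite /hroot; lia.
set q := hparent p.
have qE : (base + (p - base).-1 %/ 2)%N = q.
  by rewrite /q /hparent baseE subKn.
do 8![apply: wp_step; first by []]; rewrite qE.
apply: wp_step; first by [].
have qp : (q < p)%N := hparent_lt nrp.
case: ltP => [lt_pq | le_qp]; last first.
  apply: wp_ret; apply: QP => // s sn nr.
  by have [->|] := eqVneq s p; [exact: le_qp | exact: ord1].
apply: (@wp_bind _ _ 6 (20 * h)); first lia.
apply: wp_swap; rewrite ?(ltn_trans qp) //; first by lia.
move=> m' idx' same' keyE.
have lt_key : key m p < key m q by exact: lt_pq.
have hparent_ne s : ~~ hroot s -> s != hparent s.
  by move/hparent_lt; lia.
apply: (IH h) => //.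
- exact: ltn_trans qp pn.
- by rewrite /q hparent_base.
- by rewrite hparent_mod //; move: nrp; rewrite /hroot; move: (p %% bs)%N pfuel => r; lia.
- rewrite hparent_mod //; move: nrp rl; rewrite /hroot expnS; move: (p %% bs)%N => r; lia.
- move=> s sn nr ne_sq; rewrite !keyE (negbTE ne_sq).
  have [->|ne_sp] := eqVneq s p; first by rewrite eqxx ltW.
  have [pq|ne_psq] := eqVneq (hparent s) q.
    by rewrite (le_trans (ltW lt_key)) // -pq ord1.
  have [psp|_] := eqVneq (hparent s) p; first exact: ord2.
  exact: ord1.
- move=> s sn nr nrq psq; rewrite !keyE.
  have pqq := hparent_lt nrq.
  have [/eqP|_] := eqVneq (hparent q) q; first by lia.
  have [/eqP|_] := eqVneq (hparent q) p; first by lia.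
  have [/eqP|_] := eqVneq s q; first by have := hparent_lt nr; lia.
  have le1 : key m (hparent q) <= key m q.
    by apply: ord1 => //; [exact: ltn_trans qp pn | lia].
  have [_|ne_sp] := eqVneq s p; first by [].
  by apply: le_trans le1 _; rewrite -psq; exact: ord1.
- move=> m'' idx'' ord'' same''; apply: QP => //.
  exact: same_but_heaps_trans same''.
Qed.

(** Dual situation: the order may fail only between p and its children. Swapping
    with the smaller child moves the defect one level down, and offset + 1 at
    least doubles, so h bounds the number of levels below p. *)
Lemma wp_sift_down h fuel base stop p m t (Q : unit -> memory R n -> Prop) :
  (p < n)%N -> base = (p - p %% bs)%N -> stop = minn (base + bs) n ->
  (bs <= p %% bs + fuel)%N ->
  (bs < (p %% bs + 1) * 2 ^ h)%N -> (30 * h <= t)%N -> slots_indexed m ->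
  (forall s, (s < n)%N -> ~~ hroot s -> hparent s != p ->
     key m (hparent s) <= key m s) ->
  (forall s, (s < n)%N -> ~~ hroot s -> ~~ hroot p -> hparent s = p ->
     key m (hparent p) <= key m s) ->
  (forall m', slots_indexed m' -> heap_ordered m' -> same_but_heaps m m' -> Q tt m') ->
  wp (sift_down fuel base stop p) m t Q.
Proof.
elim: fuel h p m t => [|fuel IH] [|h] p m t //; have := slot_mod_lt p.
- by lia.
- by lia.
- by rewrite expn0; lia.
move=> rb pn baseE stopE pfuel rl tl idx ord1 ord2 QP /=.
have rp := leq_mod p bs.
apply: (@wp_leq _ (30 + 30 * h)); first by rewrite mulnS in tl.
do 5![apply: wp_step; first by []].
have rE : (p - base = p %% bs)%N by rewrite baseE subKn.
rewrite rE.
set q1 := (_ + 1)%N; have q1E : q1 = (p - p %% bs + 2 * (p %% bs) + 1)%N.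
  by rewrite /q1 baseE.
case: ltnP => /= [has1 | no1]; last first.
  apply: wp_ret; apply: QP => // s sn nr; apply: ord1 => //.
  by apply/eqP => psp; have [] := hchild nr psp; lia.
do 4![apply: wp_step; first by []].
set q2 := (q1 + 1)%N.
have [|nr1 par1 mod1 base1] := @is_hchild p 1 isT; first by lia.
rewrite -q1E in nr1 par1 mod1 base1.
set g1 := mem_g _ _.
apply: (@wp_bind _ _ 3 (18 + 30 * h)); first by lia.
(* What the selected child c must satisfy, whether or not p has two. *)
pose good (c : nat) := [/\ (c < n)%N, ~~ hroot c, hparent c = p,
   (2 * (p %% bs) + 1 <= c %% bs)%N &
   c - c %% bs = base]%N /\
   (forall s, (s < n)%N -> ~~ hroot s -> hparent s = p -> key m c <= key m s).
have q1n : (q1 < n)%N by move: has1; rewrite stopE leq_min => /andP[].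
have good1 : (forall s, (s < n)%N -> ~~ hroot s -> hparent s = p ->
    key m q1 <= key m s) -> good q1.
  by move=> min1; split=> //; split; rewrite ?base1 ?mod1 // baseE.
apply: (@wp_weaken _ (3 + 0) (fun cg m' => [/\ m' = m, cg.2 = key m cg.1 & good cg.1])).
- case: ltnP => has2.
    do 2![apply: wp_step; first by []].
    apply: wp_step; first by [].
    have q2E : q2 = (p - p %% bs + 2 * (p %% bs) + 2)%N by lia.
    have [|nr2 par2 mod2 base2] := @is_hchild p 2 isT; first by lia.
    rewrite -q2E in nr2 par2 mod2 base2.
    have q2n : (q2 < n)%N by move: has2; rewrite stopE leq_min => /andP[].
    apply: wp_ret.
    have children s : ~~ hroot s -> hparent s = p -> s = q1 \/ s = q2.
      by move=> nr /(hchild nr)[[->|->] _]; [left | right]; rewrite ?q1E ?q2E.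
    case: ltP => lt12; split=> //=.
      split; first by split; rewrite ?base2 ?mod2 ?leq_add2l // baseE.
      by move=> s _ nr /(children _ nr)[] -> //; exact: ltW.
    by apply: good1 => s _ nr /(children _ nr)[] ->.
  apply: wp_ret; split=> //; apply: good1 => s sn nr /(hchild nr)[[->|sE] sb].
    by rewrite q1E.
  by move: has2; rewrite leqNgt /q2 q1E; lia.
- by [].
case=> c gc _ [-> /= -> [[cn nrc parc modc basec] minc]].
clear good1 good g1 base1 mod1 par1 nr1 q2 q1n has1 q1E q1 rE.
do 2![apply: wp_step; first by []].
apply: wp_step; first by [].
case: ltP => [lt_cp | le_pc]; last first.
  apply: wp_ret; apply: QP => // s sn nr.
  have [psp|] := eqVneq (hparent s) p; last exact: ord1.
  by rewrite psp; apply: le_trans (minc s sn nr psp).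
have pc : (p < c)%N by rewrite -{1}parc hparent_lt.
have lt_key : key m c < key m p by exact: lt_cp.
apply: (@wp_bind _ _ 6 (30 * h)); first lia.
apply: wp_swap => //; first by rewrite neq_ltn pc.
move=> m' idx' same' keyE.
apply: (IH h) => //.
- by move: pfuel modc; clear; lia.
- apply: leq_trans rl _; rewrite expnS mulnA leq_mul2r; apply/orP; right.
  by move: modc; clear; lia.
- move=> s sn nr ne_psc; rewrite !keyE (negbTE ne_psc).
  have [->|ne_sc] := eqVneq s c; first by rewrite parc eqxx ltW.
  have [psp|ne_psp] := eqVneq (hparent s) p.
    have [/eqP|_] := eqVneq s p; first by have := hparent_lt nr; lia.
    exact: minc.
  have [sp|_] := eqVneq s p; last exact: ord1.
  by rewrite sp; apply: ord2 => //; rewrite -sp.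
- move=> s sn nr _ psc; rewrite !keyE parc.
  have lt_cs := hparent_lt nr; rewrite psc in lt_cs.
  have [/eqP|_] := eqVneq p c; first by lia.
  rewrite eqxx.
  have [/eqP|_] := eqVneq s c; first by lia.
  have [/eqP|_] := eqVneq s p; first by lia.
  by rewrite -psc; apply: ord1 => //; rewrite psc; lia.
- move=> m'' idx'' ord'' same''; apply: QP => //.
  exact: same_but_heaps_trans same''.
Qed.

End Heaps.

(** * Changing a key and finding the minimal key *)

Section HeapOperations.
Variables (R : realType) (n d : nat).
Implicit Types (m : memory R n) (i j l y : 'I_n) (p q s r b h t : nat).
Local Notation prog := (@Defs.comp R n).
Local Notation bs := (block_size n d).
Local Notation nb := (num_blocks n d).

Definition linked m := forall b, (b < nb)%N ->
  Defs.mem_next m b = if (b.+1 < nb)%N then Some b.+1 else None.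

Definition valid m := [/\ slots_indexed m, heap_ordered d m & linked m].

(** Common postcondition of all gradient updates, small or large: the shifts D of
    successive updates add up ([wp_for_each_shifted]). *)
Definition shifted (D : 'I_n -> R) m m' :=
  [/\ valid m', mem_z m' = mem_z m & forall y, mem_g m' y = mem_g m y + D y].

(** A decreased key can violate the order only towards its parent, an increased
    one only towards its children; these are the two sift preconditions. *)
Lemma wp_add_key h l (delta : R) m t (Q : unit -> memory R n -> Prop) :
  (bs < 2 ^ h)%N -> (10 + 30 * h <= t)%N -> valid m ->
  (forall m', shifted (fun y => delta * (y == l)%:R) m m' -> Q tt m') ->
  wp (add_key d l delta) m t Q.
Proof.
move=> bsh tle [idx ord lnk] QP; apply: wp_leq tle _; rewrite /add_key.
have [hp ph] := idx; have [pn hpl] := ph l.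
apply: wp_step; first by [].
apply: wp_step; first by [].
apply: wp_step; first by [].
set m1 := Memory _ _ _ _ _ _ _.
apply: wp_step; first by [].
do 2![apply: wp_step; first by []].
apply: wp_step; first by [].
pose p := mem_pos m l; rewrite -[mem_pos m1 l]/p.
have baseE : (p %/ bs * bs)%N = (p - p %% bs)%N by rewrite {2}(divn_eq p bs) addnK.
have keyE s : (s < n)%N ->
    key m1 s = if s == p then key m s + delta else key m s.
  move=> sn; rewrite /key /m1 /= /upd.
  have -> : (mem_heap m s == l) = (s == p).
    by apply/eqP/eqP => [E|->]; [rewrite /p -E hp | exact: hpl].
  by case: (eqVneq s p) => [->|_] //; rewrite /p hpl.
have key_other s : (s < n)%N -> s != p -> key m1 s = key m s.
  by move=> sn ne; rewrite keyE // (negbTE ne).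
have idx1 : slots_indexed m1 by [].
have hparent_n s : (s < n)%N -> ~~ hroot n d s -> (hparent n d s < n)%N.
  by move=> sn nr; apply: ltn_trans (hparent_lt nr) sn.
have ord2 s : (s < n)%N -> ~~ hroot n d s -> ~~ hroot n d p ->
    hparent n d s = p -> key m1 (hparent n d p) <= key m1 s.
  move=> sn nr nrp psp.
  rewrite !key_other ?hparent_n //; first last.
  - by rewrite neq_ltn hparent_lt.
  - by rewrite -psp neq_ltn hparent_lt // orbT.
  by apply: le_trans (ord _ pn nrp) _; rewrite -/p -psp; exact: ord.
have rb := slot_mod_lt n d p.
have post m' : slots_indexed m' -> heap_ordered d m' -> same_but_heaps m1 m' -> Q tt m'.
  move=> idx' ord' [zE gE nE _ _]; apply: QP; split => //.
    by split=> // b bn; rewrite nE; exact: lnk.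
  move=> y; rewrite gE /= /upd; case: eqVneq => [->|_]; first by rewrite mulr1.
  by rewrite mulr0 addr0.
case: ifPn => [delta_le0 | ]; last rewrite -ltNge => delta_gt0.
  apply: (wp_sift_up (d := d) (h := h)) => //; first by rewrite addn1; exact: leq_ltn_trans bsh.
    by rewrite (leq_trans _ (leq_addl _ _)) // leq_mul2r orbT.
  move=> s sn nr ne_sp; rewrite (key_other s) //.
  apply: le_trans (ord s sn nr); rewrite keyE ?hparent_n //.
  by case: ifP => // _; rewrite gerDl.
do 2![apply: wp_step; first by []].
apply: (wp_sift_down (d := d) (h := h)) => //.
- by rewrite leq_addl.
- by rewrite (leq_trans bsh) // leq_pmull // addn1.
- move=> s sn nr ne_psp; rewrite (key_other (hparent n d s)) ?hparent_n //.
  apply: le_trans (ord s sn nr) _; rewrite keyE //.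
  by case: ifP => // _; rewrite lerDl ltW.
Qed.

Lemma wp_for_each_shifted (T : Type) k (D : T -> 'I_n -> R)
    (body : T -> prog unit) (xs : seq T) m t (Q : unit -> memory R n -> Prop) :
  (forall x m1, valid m1 -> wp (body x) m1 k (fun _ m2 => shifted (D x) m1 m2)) ->
  (k.+1 * size xs <= t)%N -> valid m ->
  (forall m', shifted (fun y => \sum_(x <- xs) D x y) m m' -> Q tt m') ->
  wp (for_each xs body) m t Q.
Proof.
move=> bodyP tle vm QP.
apply: (wp_fold_list (k := k) (inv := fun xs' _ m' =>
  shifted (fun y => \sum_(x <- xs) D x y - \sum_(x <- xs') D x y) m m')) => //.
- move=> x xs' _ m1 [vm1 z1 g1].
  apply: wp_weaken (bodyP x m1 vm1) (leqnn _) _ => _ m2 [vm2 z2 g2].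
  split=> //; first by rewrite z2.
  by move=> y; rewrite g2 g1 big_cons; ring.
- by split=> // y; rewrite subrr addr0.
- case=> m1 [vm1 z1 g1]; apply: QP; split=> // y.
  by rewrite g1 big_nil subr0.
Qed.

(** Climbing from parent to parent ends at the root of the block. *)
Lemma root_key_min m s : heap_ordered d m -> (s < n)%N ->
  key m (s %/ bs * bs)%N <= key m s.
Proof.
move=> ord; elim/ltn_ind: s => s IH sn.
have [root_s | nr] := boolP (hroot n d s).
  by rewrite divnK.
have ps := hparent_lt nr.
apply: le_trans (ord s sn nr); have := IH _ ps (ltn_trans ps sn).
suff -> : (hparent n d s %/ bs = s %/ bs)%N by [].
apply/eqP; rewrite -(eqn_pmul2r (ltn0Sn _ : (0 < bs)%N)); apply/eqP.
have divE q : (q %/ bs * bs = q - q %% bs)%N by rewrite {2}(divn_eq q bs) addnK.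
by rewrite !divE hparent_base.
Qed.

Lemma wp_min_from fuel b (best : 'I_n * R) m t (Q : 'I_n -> memory R n -> Prop) :
  (nb <= b + fuel)%N -> (b < nb)%N -> (5 * fuel <= t)%N -> valid m ->
  best.2 = mem_g m best.1 ->
  (forall b', (b' <= b)%N -> best.2 <= key m (b' * bs)%N) ->
  (forall i, (forall b', (b' < nb)%N -> mem_g m i <= key m (b' * bs)%N) -> Q i m) ->
  wp (min_from d fuel b best) m t Q.
Proof.
elim: fuel b best t => [|fuel IH] b best t nbf bn tle vm bestE bestP QP.
  by rewrite addn0 leqNgt bn in nbf.
apply: (@wp_leq _ _ _ (5 + 5 * fuel)); first by rewrite mulnS in tle.
apply: wp_step; first by [].
case: (vm) => _ _ lnk; rewrite lnk //; case: ifP => bn1; last first.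
  apply: wp_ret; apply: QP => b' b'n; rewrite -bestE; apply: bestP.
  by move: b'n bn1; clear; lia.
do 4![apply: wp_step; first by []].
apply: IH => //; first by rewrite addSnnS.
  by case: ifP.
move=> b' le_b'; have [->|ne] := eqVneq b' b.+1.
  case: ltP => [_|//]; exact: lexx.
have le1 := bestP b'; case: ltP => [lt|_] /=.
  by apply: le_trans (ltW lt) (le1 _); move: le_b' ne; clear; lia.
by apply: le1; move: le_b' ne; clear; lia.
Qed.

Lemma wp_min_coordinate m t (Q : 'I_n -> memory R n -> Prop) :
  (2 + 5 * nb <= t)%N -> valid m ->
  (forall i, (forall y, mem_g m i <= mem_g m y) -> Q i m) ->
  wp (min_coordinate d) m t Q.
Proof.
move=> tle vm QP; apply: wp_leq tle _; rewrite /min_coordinate.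
do 2![apply: wp_step; first by []].
apply: wp_min_from => //=; first by move=> b'; rewrite leqn0 => /eqP ->.
case: vm => -[_ ph] ord _ i min_i; apply: QP => y.
have [pn hpy] := ph y; have := root_key_min ord pn.
rewrite {2}/key hpy; apply: le_trans; apply: min_i.
rewrite ltnS leq_div2r //; move: pn; clear; lia.
Qed.

End HeapOperations.

(** * Sparse updates and one iteration *)

Section SparseUpdates.
Variables (R : realType) (n d : nat) (P : 'M[R]_n) (eps : R) (i0 : 'I_n).
Implicit Types (m : memory R n) (i j l y : 'I_n) (k b h t : nat).
Local Notation prog := (@Defs.comp R n).
Local Notation bs := (block_size n d).
Local Notation nb := (num_blocks n d).

(** Loops over the sparsity pattern compute sums over all coordinates, the
    omitted terms being zero. *)
Lemma big_enum_filter (Q : pred 'I_n) (F : 'I_n -> R) :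
  (forall j, ~~ Q j -> F j = 0) ->
  \sum_(j <- [seq j <- enum 'I_n | Q j]) F j = \sum_j F j.
Proof.
move=> F0; rewrite big_filter enumT [RHS](bigID Q) /=.
by rewrite [X in _ + X]big1 ?addr0 //; rewrite enumT.
Qed.

Lemma Amx_pattern_col i j : ~~ ((P i j != 0) || (j == i)) -> Amx P j i = 0.
Proof.
rewrite negb_or negbK AmxE => /andP[/eqP -> ne].
by rewrite eq_sym (negbTE ne) subr0.
Qed.

Lemma Amx_pattern_row j l : ~~ ((P l j != 0) || (l == j)) -> Amx P j l = 0.
Proof. by rewrite [l == j]eq_sym; exact: Amx_pattern_col. Qed.

Lemma size_filter_enum (Q : pred 'I_n) i :
  (size [seq j <- enum 'I_n | Q j || (j == i)] <= #|[set j | Q j]|.+1)%N.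
Proof.
have -> : size [seq j <- enum 'I_n | Q j || (j == i)] =
    #|[set j | Q j] :|: [set i]|.
  rewrite cardE [X in _ = size X]/enum_mem -enumT !size_filter.
  by apply: eq_count => j; rewrite !inE.
by apply: leq_trans (leq_card_setU _ _) _; rewrite cards1 addn1.
Qed.

Lemma size_pattern_le i : (size (pattern_col P i) <= n)%N.
Proof.
by rewrite size_filter (leq_trans (count_size _ _)) // size_enum_ord.
Qed.

Lemma wp_entryA j i m t (Q : R -> memory R n -> Prop) :
  (3 <= t)%N -> Q (Amx P j i) m -> wp (entryA P j i) m t Q.
Proof.
move=> tle QP; apply: (@wp_leq _ _ _ (3 + 0)) => //; rewrite /entryA.
do 2![apply: wp_step; first by []].
move: QP; rewrite AmxE; case: eqP => _ QP.
  by apply: wp_last.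
by apply: wp_ret; rewrite subr0 in QP.
Qed.

Definition colnorm i : R := dot (Amx P *m unitv R i) (Amx P *m unitv R i).

Lemma colnormE i : colnorm i = \sum_j Amx P j i * Amx P j i.
Proof. by apply: eq_bigr => j _; rewrite Amx_unitv. Qed.

Lemma wp_sqnorm_col i m t (Q : R -> memory R n -> Prop) :
  (6 * size (pattern_col P i) <= t)%N -> Q (colnorm i) m ->
  wp (sqnorm_col P i) m t Q.
Proof.
move=> tle QP.
apply: (wp_fold_list (k := 5) (inv := fun xs acc m' => m' = m /\
  acc = colnorm i - \sum_(j <- xs) Amx P j i * Amx P j i)) => //.
- move=> j xs acc _ [-> accE].
  apply: (@wp_bind _ _ _ _ 3 (2 + 0)) => //; apply: wp_entryA => //.
  apply: wp_step; first by [].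
  apply: wp_last; first by [].
  by split=> //; rewrite accE big_cons; ring.
- split=> //; rewrite big_enum_filter ?colnormE ?subrr // => j Qj.
  by rewrite (Amx_pattern_col Qj) mul0r.
- by move=> acc m' [-> ->]; rewrite big_nil subr0.
Qed.

Hypothesis spP : sparse d P.

Lemma size_pattern_col i : (size (pattern_col P i) <= d.+1)%N.
Proof.
apply: leq_trans (size_filter_enum (fun j => P i j != 0) i) _.
by rewrite ltnS; case: spP.
Qed.

Lemma size_pattern_row j : (size (pattern_row P j) <= d.+1)%N.
Proof.
apply: leq_trans (size_filter_enum (fun l => P l j != 0) j) _.
by rewrite ltnS; case: spP.
Qed.

Definition gradient_cost h := ((5 + (15 + 30 * h) * d.+1) * d.+1)%N.

(** The double loop adds c A_ji A_jl to coordinate l for all j, l in the pattern;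
    summed over j this is c times entry l of A^T A h. *)
Lemma wp_add_gradient h i (c : R) m t (Q : unit -> memory R n -> Prop) :
  (bs < 2 ^ h)%N -> (gradient_cost h <= t)%N -> valid d m ->
  (forall m', shifted d (fun y => c * grad P (unitv R i) y 0) m m' -> Q tt m') ->
  wp (add_gradient P d i c) m t Q.
Proof.
move=> bsh tle vm QP.
apply: (wp_for_each_shifted (d := d) (k := 4 + (15 + 30 * h) * d.+1)
  (D := fun j y => c * Amx P j i * Amx P j y)) => //; first last.
- move=> m' [vm' zE gE]; apply: QP; split=> // y; rewrite gE; congr (_ + _).
  rewrite big_enum_filter => [|j Qj]; last first.
    by rewrite (Amx_pattern_col Qj) mulr0 mul0r.
  rewrite gradE mulr_sumr; apply: eq_bigr => j _.
  by rewrite !Amx_unitv mulrA.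
- by apply: leq_trans tle; rewrite leq_mul2l size_pattern_col orbT.
- move=> j m1 vm1.
  apply: (@wp_bind _ _ _ _ 3 (1 + (15 + 30 * h) * d.+1)) => //.
  apply: wp_entryA => //.
  apply: wp_step; first by [].
  apply: (wp_for_each_shifted (d := d) (k := 14 + 30 * h)
    (D := fun l y => c * Amx P j i * Amx P j l * (y == l)%:R)) => //.
  + move=> l m2 vm2.
    apply: (@wp_bind _ _ _ _ 3 (1 + (10 + 30 * h))) => //.
    apply: wp_entryA => //.
    apply: wp_step; first by [].
    exact: (wp_add_key bsh).
  + by rewrite leq_mul2l size_pattern_row orbT.
  + move=> m2 [vm2 zE gE]; split=> // y; rewrite gE; congr (_ + _).
    rewrite big_enum_filter => [|l Ql]; last first.
      by rewrite (Amx_pattern_row Ql) mulr0 mul0r.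
    rewrite (bigD1 y) //= eqxx mulr1 big1 ?addr0 // => l ne.
    by rewrite eq_sym (negbTE ne) mulr0.
Qed.

Definition zvec m : 'cV[R]_n := \col_i mem_z m i.

(** Invariant of the implicit representation, stated for z alone: the scalar
    beta enters neither the stored gradient nor the stored value. *)
Definition represents m (F : R) :=
  [/\ valid d m, forall y, mem_g m y = grad P (zvec m) y 0 &
      F = objective P (zvec m)].

Lemma grad_shift (z : 'cV[R]_n) i (c : R) y :
  grad P (z + c *: unitv R i) y 0 =
  grad P z y 0 + c * grad P (unitv R i) y 0.
Proof. by rewrite /grad !mulmxDr mxE -gradZ. Qed.

Definition update_cost h := (10 + (6 * d.+1 + gradient_cost h))%N.

Lemma wp_sparse_update h (F : R) i (c : R) m t (Q : R -> memory R n -> Prop) :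
  (bs < 2 ^ h)%N -> (update_cost h <= t)%N -> represents m F ->
  (forall F' m', represents m' F' -> zvec m' = zvec m + c *: unitv R i ->
     Q F' m') ->
  wp (sparse_update P d F i c) m t Q.
Proof.
move=> bsh tle [vm gE FE] QP; apply: wp_leq tle _.
rewrite /update_cost /sparse_update.
do 5![apply: wp_step; first by []].
set m1 := Memory _ _ _ _ _ _ _.
apply: (@wp_bind _ _ _ _ (6 * d.+1) (5 + gradient_cost h)).
  by move: (gradient_cost h); clear; lia.
apply: wp_sqnorm_col; first by rewrite leq_mul2l size_pattern_col.
do 5![apply: wp_step; first by []].
apply: (@wp_bind _ _ _ _ (gradient_cost h) 0); first by rewrite addn0.
apply: (wp_add_gradient bsh) => // m' [vm' zE gE'].
have zvecE : zvec m' = zvec m + c *: unitv R i.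
  apply/colP => y; rewrite !mxE zE /= /upd eqxx andbT.
  by case: eqP => [->|_]; rewrite ?mulr1 // mulr0 addr0.
apply: wp_ret; apply: QP => //; split=> //.
  by move=> y; rewrite gE' gE zvecE grad_shift.
by rewrite zvecE objective_shift -gE -FE.
Qed.

Lemma wp_stop_test (beta F : R) m t (Q : bool -> memory R n -> Prop) :
  0 < eps -> (5 <= t)%N -> F = objective P (zvec m) ->
  Q (l2norm (Amx P *m (beta *: zvec m)) <= eps) m ->
  wp (stop_test eps beta F) m t Q.
Proof.
move=> e0 tle FE QP; apply: (@wp_leq _ _ _ (5 + 0)) => //.
do 4![apply: wp_step; first by []].
apply: wp_last; first by [].
move: QP; rewrite l2norm_le // -scalemxAr.
congr (Q (_ <= _) m); rewrite FE objectiveE /dot !mulr_sumr.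
by apply: eq_bigr => j _; rewrite mxE; field.
Qed.

Definition iteration_cost h := (12 + 5 * nb + 2 * update_cost h)%N.

(** As beta > 0, minimizing a coordinate of A^T A z is the same as minimizing the
    partial derivative at x = beta z. In the first iteration gamma = 1 and z is
    the initial vertex, so removing it and adding the new unit vector realizes
    the step. Afterwards beta' = beta (1 - gamma) is nonzero, and
    beta' (z + (gamma / beta') h) = (1 - gamma) x + gamma h. *)
Lemma wp_iteration h k (beta F : R) m t (Q : R * R -> memory R n -> Prop) :
  (bs < 2 ^ h)%N -> (iteration_cost h <= t)%N -> (0 < k)%N ->
  0 < beta -> (k = 1%N -> beta = 1 /\ zvec m = unitv R i0) ->
  represents m F ->
  (forall i beta' F' m', represents m' F' -> 0 < beta' ->
     argmin_partial (objective P) (beta *: zvec m) i ->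
     beta' *: zvec m' =
       (1 - gamma R k) *: (beta *: zvec m) + gamma R k *: unitv R i ->
     Q (beta', F') m') ->
  wp (iteration P d i0 k beta F) m t Q.
Proof.
move=> bsh tle k0 beta0 first_k rep QP; apply: wp_leq tle _.
rewrite /iteration_cost; move: (update_cost h) (@wp_sparse_update h) => u updP.
apply: (@wp_bind _ _ _ _ (2 + 5 * nb) (10 + 2 * u)).
  by move: nb; clear; lia.
case: (rep) => vm gE _.
apply: wp_min_coordinate vm _ => // i min_i.
have argmin_i : argmin_partial (objective P) (beta *: zvec m) i.
  by apply/argmin_partial_grad => y; rewrite !gradZ -!gE ler_pM2l.
apply: wp_step; first by [].
case: eqP => [k1 | k1].
  have [beta1 z1] := first_k k1.
  apply: (@wp_bind _ _ _ _ u u); first by clear; lia.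
  apply: (updP _ _ _ _ _ _ bsh) => // F1 m1 rep1 z1E.
  apply: (@wp_bind _ _ _ _ u 0); first by rewrite addn0.
  apply: (updP _ _ _ _ _ _ bsh) => // F2 m2 rep2 z2E.
  apply: wp_ret; apply: (QP i) => //; rewrite z2E z1E z1 k1 /gamma beta1.
  by rewrite divff // subrr scale0r !scale1r scaleN1r subrr.
do 6![apply: wp_step; first by []].
apply: (@wp_bind _ _ _ _ u 0); first by clear; lia.
apply: (updP _ _ _ _ _ _ bsh) => // F1 m1 rep1 z1E.
have k2 : 2 < k.+1%:R :> R by rewrite ltr_nat; lia.
have fac0 : 0 < 1 - 2 / k.+1%:R :> R.
  by rewrite subr_gt0 ltr_pdivrMr ?mul1r //; lra.
apply: wp_ret; apply: (QP i) => //; first by rewrite mulr_gt0.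
rewrite z1E scalerDr !scalerA /gamma; congr (_ *: _ + _ *: _); first by rewrite mulrC.
by rewrite mulrCA divff ?mulr1 // gt_eqF // mulr_gt0.
Qed.

End SparseUpdates.

(** * The whole program *)

Section Runs.
Variables (R : realType) (n d : nat) (P : 'M[R]_n) (eps : R) (i0 : 'I_n).
Implicit Types (m : memory R n) (i j l y : 'I_n) (k b h t : nat).
Local Notation bs := (block_size n d).
Local Notation nb := (num_blocks n d).

Lemma wp_init_z m t (Q : unit -> memory R n -> Prop) :
  (2 * n + 1 <= t)%N -> (forall m', zvec m' = unitv R i0 -> Q tt m') ->
  wp (init_z i0) m t Q.
Proof.
move=> tle QP; apply: (wp_bind tle).
apply: (wp_fold_list (k := 1) (inv := fun xs _ m' =>
  forall i, i \notin xs -> mem_z m' i = 0)).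
- move=> i xs _ m1 zE; apply: (@wp_leq _ _ _ (1 + 0)) => //; apply: wp_last; first by [].
  move=> j j_xs; rewrite /= /upd; case: eqP => // /eqP ne.
  by rewrite zE // inE negb_or ne.
- by rewrite size_enum_ord.
- by move=> i; rewrite mem_enum.
- move=> _ m1 zE; apply: (@wp_leq _ _ _ (1 + 0)) => //; apply: wp_last; first by [].
  apply: QP; apply/colP => i; rewrite !mxE /= /upd eqxx andbT.
  by case: eqP => // _; rewrite zE.
Qed.

Lemma wp_init_heaps m t (Q : unit -> memory R n -> Prop) :
  (4 * n + 7 * nb <= t)%N ->
  (forall m', valid d m' -> mem_z m' = mem_z m -> (forall y, mem_g m' y = 0) ->
     Q tt m') ->
  wp (init_heaps d) m t Q.
Proof.
move=> tle QP; apply: (wp_bind tle).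
apply: (wp_fold_list (k := 3) (inv := fun xs _ m' =>
  mem_z m' = mem_z m /\ (forall i, i \notin xs ->
    [/\ mem_g m' i = 0, mem_heap m' i = i & mem_pos m' i = i]))).
- move=> i xs _ m1 [zE E]; apply: (@wp_leq _ _ _ (3 + 0)) => //.
  do 2![apply: wp_step; first by []].
  apply: wp_last; first by [].
  split=> // j j_xs; rewrite /= /upd; have [->|ne] := eqVneq j i.
    by rewrite eqxx.
  have [|-> -> ->] := E j; first by rewrite inE negb_or ne.
  by rewrite -[_ == _]/(j == i) (negbTE ne).
- by rewrite size_enum_ord.
- by split=> // i; rewrite mem_enum.
move=> _ m1 [zE E].
have {}E i : [/\ mem_g m1 i = 0, mem_heap m1 i = i & mem_pos m1 i = i] by exact: E.
pose inv (xs : seq nat) (_ : unit) m' :=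
  [/\ mem_z m' = mem_z m1, mem_g m' = mem_g m1, mem_heap m' = mem_heap m1,
      mem_pos m' = mem_pos m1 &
      forall b, (b < nb)%N -> b \notin xs ->
        Defs.mem_next m' b = if (b.+1 < nb)%N then Some b.+1 else None].
apply: (wp_fold_list (k := 6) (inv := inv)).
- move=> b xs _ m2 [z2 g2 h2 p2 next2].
  apply: (@wp_leq _ _ _ (6 + 0)) => //.
  do 4![apply: wp_step; first by []].
  have next3 b' : (b' < nb)%N -> b' \notin xs ->
    upd (Defs.mem_next m2) b (if (b.+1 < nb)%N then Some b.+1 else None) b' =
      if (b'.+1 < nb)%N then Some b'.+1 else None.
    move=> b'n b'xs; rewrite /upd; have [->//|ne] := eqVneq b' b.
    by apply: next2; rewrite // inE negb_or ne.
  case: ifP => _; first by apply: wp_last.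
  apply: wp_step; first by [].
  by apply: wp_last.
- by rewrite size_iota.
- by split=> // b bn; rewrite mem_iota /= add0n bn.
case=> m2 [z2 g2 h2 p2 next2]; apply: QP; last 2 first.
- by rewrite z2.
- by move=> y; rewrite g2; case: (E y).
split; last by move=> b bn; apply: next2.
- rewrite /slots_indexed h2 p2; split=> [s sn | i].
    by have [_ hs ps] := E (Ordinal sn); move: hs ps => /= -> ->.
  by have [_ hi pi] := E i; rewrite pi hi.
- move=> s sn nr; rewrite /key g2; case: (E (mem_heap m2 s)) => -> _ _.
  by case: (E (mem_heap m2 (hparent n d s))) => ->.
Qed.

Lemma wp_output (beta : R) m t (Q : unit -> memory R n -> Prop) :
  (4 * n <= t)%N ->
  (forall m', \col_i mem_out m' i = beta *: zvec m -> Q tt m') ->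
  wp (output beta) m t Q.
Proof.
move=> tle QP.
apply: (wp_fold_list (k := 3) (inv := fun xs _ m' =>
  mem_z m' = mem_z m /\ forall i, i \notin xs -> mem_out m' i = beta * mem_z m i)).
- move=> i xs _ m1 [zE outE]; apply: (@wp_leq _ _ _ (3 + 0)) => //.
  do 2![apply: wp_step; first by []].
  apply: wp_last; first by [].
  split=> // j j_xs; rewrite /= /upd; case: eqP => [->|/eqP ne].
    by rewrite zE.
  by rewrite outE // inE negb_or ne.
- by rewrite size_enum_ord.
- by split=> // i; rewrite mem_enum.
- case=> m1 [_ outE]; apply: QP; apply/colP => i; rewrite !mxE.
  exact: outE.
Qed.

Definition state : Type := (R * R) * memory R n.

(** The loop body as a total function on states ((beta, F), memory): iterating it
    beyond the stopping time extends the iterates to an infinite sequence. *)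
Definition advance k (s : state) : state :=
  let: (v, m, _) := iteration P d i0 k s.1.1 s.1.2 s.2 in (v, m).

Fixpoint run (s : state) (k : nat) : state :=
  if k is k'.+1 then advance k (run s k') else s.

Definition iterate (s : state) : 'cV[R]_n := s.1.1 *: zvec s.2.

(** Invariant of the state at the beginning of iteration k. The first iteration
    relies on the form of the initial state. *)
Definition consistent k (s : state) :=
  [/\ 0 < s.1.1, k = 1%N -> s.1.1 = 1 /\ zvec s.2 = unitv R i0 &
      represents d P s.2 s.1.2].

Hypothesis spP : sparse d P.
Variable h : nat.
Hypothesis bsh : (bs < 2 ^ h)%N.

Lemma advanceP k s : (0 < k)%N -> consistent k s ->
  [/\ wp (iteration P d i0 k s.1.1 s.1.2) s.2 (iteration_cost n d h)
        (fun v m => (v, m) = advance k s),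
      consistent k.+1 (advance k s) &
      exists2 i, argmin_partial (objective P) (iterate s) i &
        iterate (advance k s) =
          (1 - gamma R k) *: iterate s + gamma R k *: unitv R i].
Proof.
move=> k0 [beta0 first_k rep].
pose post v m := consistent k.+1 (v, m) /\
  exists2 i, argmin_partial (objective P) (iterate s) i &
    iterate (v, m) = (1 - gamma R k) *: iterate s + gamma R k *: unitv R i.
have : wp (iteration P d i0 k s.1.1 s.1.2) s.2 (iteration_cost n d h) post.
  apply: (wp_iteration spP bsh) => // i beta' F' m' rep' beta'0 min_i xE.
  by split; [split=> //= -[k_0]; rewrite k_0 in k0 | exists i].
rewrite /wp /advance.
by case: (iteration _ _ _ _ _ _ _) => -[v m] c [cle [cons ex]].
Qed.

Lemma run_consistent s k : consistent 1 s -> consistent k.+1 (run s k).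
Proof.
move=> cons1; elim: k => [//|k IHk].
by have [] := advanceP (ltn0Sn k) IHk.
Qed.

Lemma run_SFW s : consistent 1 s ->
  SFW_sequence P (fun k => iterate (run s k.-1)).
Proof.
move=> cons1; split.
  by exists i0; case: cons1 => _ [] // beta1 z1 _; rewrite /iterate /= beta1 scale1r.
case=> // k _; have [_ _ [i min_i xE]] := advanceP (ltn0Sn k) (run_consistent k cons1).
by exists i.
Qed.

Lemma wp_main_loop s fuel k T t (Q : option (nat * R) -> memory R n -> Prop) :
  0 < eps -> consistent 1 s -> (k + fuel = T)%N ->
  (5 + fuel * (6 + iteration_cost n d h) <= t)%N ->
  (forall j : nat, (k <= j < T)%N -> eps < l2norm (Amx P *m iterate (run s j))) ->
  l2norm (Amx P *m iterate (run s T)) <= eps ->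
  Q (Some (T.+1, (run s T).1.1)) (run s T).2 ->
  wp (main_loop P d eps i0 fuel k.+1 (run s k).1.1 (run s k).1.2) (run s k).2 t Q.
Proof.
move=> e0 cons1; elim: fuel k t => [|fuel IH] k t.
  rewrite addn0 mul0n addn0 => <- tle _ stopT QP /=.
  apply: (@wp_bind _ _ _ _ 5 0) => //.
  have [_ _ [_ _ FE]] := run_consistent k cons1.
  by apply: (wp_stop_test (P := P)) => //; rewrite -[_ *: _]/(iterate (run s k)) stopT.
rewrite addnS => kT tle not_stop stopT QP.
apply: (@wp_leq _ _ _ (5 + (iteration_cost n d h + (1 + (5 + fuel * (6 + iteration_cost n d h)))))).
  by apply: leq_trans tle; rewrite mulSn; clear; lia.
have consk := run_consistent k cons1.
apply: (@wp_bind _ _ _ _ 5 _) => //.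
have [_ _ [_ _ FE]] := consk.
apply: (wp_stop_test (P := P)) => //; rewrite -[_ *: _]/(iterate (run s k)) leNgt.
rewrite not_stop /=; last by rewrite -kT leqnn ltnS leq_addr.
have [wp_it _ _] := advanceP (ltn0Sn k) consk.
apply: (@wp_bind _ _ _ _ (iteration_cost n d h) _) => //.
apply: wp_weaken wp_it (leqnn _) _ => v m vmE.
apply: wp_step; first by [].
have -> : v = (run s k.+1).1 by rewrite /= -vmE.
have -> : m = (run s k.+1).2 by rewrite /= -vmE.
apply: IH => //.
by move=> j /andP[kj jT]; apply: not_stop; rewrite ltnW.
Qed.

Hypothesis trP : transition_matrix P.

(** When the test succeeds on the initial vertex the program skips the heaps, but
    the sequence of iterates still needs them: the set-up is run on the side. *)
Lemma sfw_run m0 : 0 < eps ->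
  exists (fuel T cost : nat) (m : memory R n) (x : nat -> 'cV[R]_n),
    [/\ sfw P d eps i0 fuel m0 = (Some T, m, cost),
        SFW_sequence P x /\ x 1%N = unitv R i0,
        stops_after P eps x T,
        \col_i mem_out m i = x T.+1 &
        (T%:R <= 32 * eps ^- 2 :> R) /\
        if l2norm (Amx P *m unitv R i0) <= eps then (cost <= 20 * n)%N else
        (cost <= 31 * n + 7 * nb + gradient_cost d h
                 + T * (6 + iteration_cost n d h))%N].
Proof.
move=> e0; have n0 : (0 < n)%N := leq_ltn_trans (leq0n i0) (ltn_ord i0).
have : wp (init_z i0) m0 (2 * n + 1) (fun _ m => zvec m = unitv R i0).
  by apply: wp_init_z.
rewrite {1}/wp; case E1: (init_z i0 m0) => [[[] m1] c1] [c1le z1].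
have : wp (init_heaps d) m1 (4 * n + 7 * nb) (fun _ m =>
    [/\ valid d m, mem_z m = mem_z m1 & forall y, mem_g m y = 0]).
  by apply: wp_init_heaps.
rewrite {1}/wp; case E2: (init_heaps d m1) => [[[] m2] c2] [c2le [vm2 z2 g2]].
have : wp (add_gradient P d i0 1) m2 (gradient_cost d h) (fun _ m =>
    shifted d (fun y => 1 * grad P (unitv R i0) y 0) m2 m).
  by apply: (wp_add_gradient spP bsh).
rewrite {1}/wp; case E3: (add_gradient P d i0 1 m2) => [[[] m3] c3].
move=> [c3le [vm3 z3 g3]].
have z3E : zvec m3 = unitv R i0 by rewrite -z1 /zvec z3 z2.
pose F := colnorm P i0 / 2; pose s0 : state := ((1, F), m3).
have FE m : zvec m = unitv R i0 -> F = objective P (zvec m).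
  by move=> ->; rewrite objectiveE mulrC.
have cons1 : consistent 1 s0.
  split=> //; split=> //; last exact: FE.
  by move=> y; rewrite g3 g2 add0r mul1r z3E.
pose x k := iterate (run s0 k.-1).
have Sx : SFW_sequence P x := run_SFW cons1.
have x1 : x 1%N = unitv R i0 by rewrite /x /iterate /= scale1r.
have [T stopsT Tle] := SFW_stops trP e0 Sx.
(* Every budget below is carved out of B; 9 n + 7 covers the steps up to and
   including the first stopping test. *)
pose B := if l2norm (Amx P *m unitv R i0) <= eps then (20 * n)%N else
  (31 * n + 7 * nb + gradient_cost d h + T * (6 + iteration_cost n d h))%N.
suff : wp (sfw P d eps i0 T) m0 B (fun r m => r = Some T /\
    \col_i mem_out m i = x T.+1).
  rewrite /wp; case E: (sfw P d eps i0 T m0) => [[r m] cost] [cle [rE outE]].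
  exists T, T, cost, m, x; split=> //; first by rewrite E rE.
  by split=> //; move: cle; rewrite /B; case: ifP.
have B_le : (9 * n + 7 + (B - (9 * n + 7)) <= B)%N.
  by rewrite subnKC // /B; case: ifP => _; move: n0; clear; lia.
apply: (@wp_bind _ _ _ _ (2 * n + 1) (7 * n + 6 + (B - (9 * n + 7)))).
  by apply: leq_trans B_le; move: (B - _)%N; clear; lia.
rewrite {1}/wp E1; split=> //.
apply: (@wp_bind _ _ _ _ (6 * n) (1 + (5 + (n + (B - (9 * n + 7)))))).
  by move: (B - _)%N; clear; lia.
apply: wp_sqnorm_col; first by rewrite leq_mul2l size_pattern_le.
apply: wp_step; first by [].
apply: (@wp_bind _ _ _ _ 5 (n + (B - (9 * n + 7)))) => //.
apply: (wp_stop_test (P := P)) => //; first exact: FE.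
rewrite scale1r z1.
case: ifP => stop1; move: @B B_le; rewrite stop1 /= => B_le.
  have T0 : T = 0%N.
    case: T stopsT {Tle B_le} => // T [_ /(_ 1%N isT)].
    by rewrite x1 ltNge stop1.
  apply: (@wp_bind _ _ _ _ (4 * n) 0); first by clear; lia.
  apply: wp_output => // m outE; apply: wp_ret; split; first by rewrite T0.
  by rewrite outE z1 T0 x1 scale1r.
set G := gradient_cost d h in c3le B_le *; set I := (T * _)%N in B_le *.
apply: (@wp_bind _ _ _ _ (4 * n + 7 * nb) (G + (5 + I) + 4 * n + 1)).
  by move: n0; clear; lia.
rewrite {1}/wp E2; split=> //.
apply: (@wp_bind _ _ _ _ G ((5 + I) + 4 * n + 1)); first by clear; lia.
rewrite {1}/wp E3; split=> //.
apply: (@wp_bind _ _ _ _ (5 + I) (4 * n + 1)); first by clear; lia.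
apply: (wp_main_loop (s := s0) (k := 0) (T := T)) => //.
- move=> j jT; have [_ /(_ j.+1)] := stopsT; apply; exact: jT.
- by have [] := stopsT.
apply: (@wp_bind _ _ _ _ (4 * n) (1 + 0)) => //.
by apply: wp_output => // m outE.
Qed.

End Runs.

(** * The total cost *)

Section Cost.
Variables (R : realType) (n d : nat).
Local Notation bs := (block_size n d).
Local Notation nb := (num_blocks n d).
Local Notation L := (ln (2 + n%:R / d%:R ^+ 2) : R).

(** Equivalent to exp (- 1/2) >= 1 - 1/2, an instance of exp x >= 1 + x. *)
Lemma ln2_ge : 1 / 2 <= ln 2 :> R.
Proof.
rewrite -ler_expR lnK ?posrE // -[leRHS]invrK.
rewrite -[expR _]invrK lef_pV2 ?posrE ?invr_gt0 ?expR_gt0 // -expRN.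
by apply: le_trans (expR_ge1Dx _); lra.
Qed.

Lemma num_blocks_le_n : (0 < n)%N -> (nb <= n)%N.
Proof.
by move=> n0; rewrite -[leqRHS](prednK n0) /num_blocks ltnS leq_div.
Qed.

Lemma num_blocks_le_sqr : (0 < d)%N -> (nb <= d * d)%N.
Proof.
move=> d0; rewrite /num_blocks ltn_divLR // /block_size mulnn.
by rewrite mulnC -ltn_divLR // expn_gt0 d0.
Qed.

(** A power of two below the block size is below 2 + n / d^2, and ln 2 >= 1/2
    turns binary into natural logarithms; the successor is absorbed by
    ln (2 + n / d^2) >= ln 2 >= 1/2. *)
Lemma block_size_depth : (0 < d)%N ->
  (trunc_log 2 bs).+1%:R <= 4 * L.
Proof.
move=> d0; have dR : 0 < d%:R ^+ 2 :> R by rewrite exprn_gt0 // ltr0n.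
have q0 : 0 <= n%:R / d%:R ^+ 2 :> R by rewrite divr_ge0 // ltW.
have ln_ge : ln 2 <= L by rewrite ler_ln ?posrE; lra.
have bs_le : bs%:R <= 2 + n%:R / d%:R ^+ 2 :> R.
  rewrite /block_size -natr1 [2]mulr2n addrC -addrA lerD2l ler_wpDl //.
  rewrite ler_pdivlMr // -natrX -natrM ler_nat.
  by apply: leq_trans (leq_divM _ _) (leq_pred n).
have : (2 ^ trunc_log 2 bs <= bs)%N by apply: trunc_logP.
rewrite -(ler_nat R) natrX => pow_le.
have : ln (2 ^+ trunc_log 2 bs) <= L.
  by rewrite ler_ln ?posrE ?exprn_gt0 //; exact: le_trans bs_le.
rewrite lnXn // -[_ *+ trunc_log _ _]mulr_natr -[(trunc_log _ _).+1%:R]natr1; have := ln2_ge.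
move: (ln 2 : R) L ln_ge (trunc_log 2 bs)%:R (ler0n R (trunc_log 2 bs)).
by move=> l2 l l2_le a a0 l2_ge al2_le; nra.
Qed.

(** As d + 1 <= 2 d and h >= 1, a gradient update costs at most 190 d^2 h. An
    iteration makes at most two of them and visits at most d^2 roots; 448 covers
    this and the lower order terms. *)
Lemma costs_le h : (0 < d)%N -> (0 < h)%N ->
  (gradient_cost d h <= 448 * (d * d * h) /\
   6 + iteration_cost n d h <= 448 * (d * d * h))%N.
Proof.
move=> d0 h0; have nb_le := num_blocks_le_sqr d0.
have d1 : (d.+1 <= 2 * d)%N by lia.
have g_le : (gradient_cost d h <= 190 * (d * d * h))%N.
  apply: leq_trans (_ : ((95 * h * d) * (2 * d) <= _))%N; last by lia.
  apply: leq_mul => //; apply: leq_trans (_ : 5 * (h * d) + 45 * h * (2 * d) <= _)%N.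
    apply: leq_add; first by rewrite leq_pmulr // muln_gt0 h0.
    by apply: leq_mul => //; lia.
  by lia.
have dd : (d <= d * d)%N by rewrite leq_pmulr.
have ddh : (d * d <= d * d * h)%N by rewrite leq_pmulr.
rewrite /iteration_cost /update_cost; move: (gradient_cost d h) g_le => G.
move: (d * d * h)%N (d * d)%N dd ddh nb_le => X Y; move: nb => N; lia.
Qed.

(** The initial gradient update counts as one more iteration, and
    T + 1 <= 34 / eps^2 because 1 <= 2 / eps^2. The logarithmic part is then at
    most 448 * 34 * 4 = 60928 times d^2 ln (2 + n / d^2) / eps^2. *)
Lemma cost_bound (eps : R) (T cost h : nat) :
  (0 < n)%N -> (0 < d)%N -> 0 < eps -> eps ^+ 2 <= 2 ->
  T%:R <= 32 * eps ^- 2 -> (0 < h)%N -> h%:R <= 4 * L ->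
  (cost <= 31 * n + 7 * nb + gradient_cost d h
           + T * (6 + iteration_cost n d h))%N ->
  cost%:R <= (70 * 1000)%:R * time_bound n d eps.
Proof.
move=> n0 d0 e0 e2 Tle h0 hle.
have [G_le I_le] := costs_le d0 h0; have nb_le := num_blocks_le_n n0.
have e20 : 0 < eps ^+ 2 by rewrite exprn_gt0.
set X := (d * d * h)%N in G_le I_le.
have {}I_le : (T * (6 + iteration_cost n d h) <= T * (448 * X))%N.
  by rewrite leq_mul2l I_le orbT.
move=> cost_le.
have {}cost_le : (cost <= 38 * n + 448 * (T.+1 * X))%N.
  move: cost_le G_le I_le nb_le; rewrite [(T.+1 * X)%N]mulSn (mulnCA T 448).
  move: (T * X)%N (T * (6 + _))%N (gradient_cost d h) nb; clear; lia.
apply: le_trans (_ : (38 * n + 448 * (T.+1 * X))%:R <= _); first by rewrite ler_nat.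
have e1 : 1 <= 2 * eps ^- 2 by rewrite ler_pdivlMr ?mul1r.
have T1 : T.+1%:R <= 34 * eps ^- 2 :> R by rewrite -[T.+1%:R]natr1; lra.
have X_le : X%:R <= 4 * (d%:R ^+ 2 * L) :> R.
  by rewrite /X !natrM -expr2 mulrCA; apply: ler_wpM2l.
have TX : T.+1%:R * X%:R <= 34 * eps ^- 2 * (4 * (d%:R ^+ 2 * L)).
  exact: ler_pM.
clearbody X; rewrite /time_bound natrD !natrM.
have : 0 <= X%:R :> R by [].
move: (T.+1%:R * X%:R) (d%:R ^+ 2 * L) X_le TX => Y Z X_le YZ X0.
have : 0 <= Z / eps ^+ 2 by rewrite divr_ge0 //; lra.
move: YZ (ler0n R n).
rewrite (_ : 34 * eps ^- 2 * (4 * Z) = 136 * (Z / eps ^+ 2)); last by ring.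
move: (Z / eps ^+ 2) (n%:R : R) => W N; lra.
Qed.

End Cost.

(** * Iteration count and running time of S-FW *)

Theorem theorem3p1 :
  exists C : nat,
  forall (R : realType) (n d : nat) (P : 'M[R]_n) (eps : R),
    transition_matrix P -> sparse d P -> 0 < eps ->
    (forall x : nat -> 'cV[R]_n, SFW_sequence P x ->
       exists T : nat,
         [/\ stops_after P eps x T,
             T%:R <= 32 * eps ^- 2 &
             l2norm (P^T *m x T.+1 - x T.+1) <= eps]) /\
    (forall (i0 : 'I_n) (m0 : memory R n),
       exists (fuel T cost : nat) (m : memory R n) (x : nat -> 'cV[R]_n),
         [/\ sfw P d eps i0 fuel m0 = (Some T, m, cost),
             SFW_sequence P x /\ x 1%N = unitv R i0,
             stops_after P eps x T,
             \col_i mem_out m i = x T.+1 &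
             cost%:R <= C%:R * time_bound n d eps]).
Proof.
exists (70 * 1000)%N => R n d P eps trP spP e0; split.
  move=> x Sx; have [T stopsT Tle] := SFW_stops trP e0 Sx.
  exists T; split=> //; case: stopsT => stopT _.
  by rewrite /Amx mulmxBl mul1mx in stopT.
move=> i0 m0; have n0 : (0 < n)%N := leq_ltn_trans (leq0n i0) (ltn_ord i0).
(* A row of P sums to 1, hence has a nonzero entry. *)
have d0 : (0 < d)%N.
  rewrite lt0n; apply/eqP => d_0; case: spP => /(_ i0); rewrite d_0 leqn0.
  rewrite cards_eq0 => /eqP row0 _; case: trP => _ /(_ i0).
  rewrite big1 => [/esym/eqP|j _]; first by rewrite oner_eq0.
  have /finset.setP/(_ j) := row0; rewrite finset.in_set0 inE => /negbFE/eqP.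
  exact.
have bsh : (block_size n d < 2 ^ (trunc_log 2 (block_size n d)).+1)%N.
  exact: trunc_log_ltn.
have [fuel [T [cost [m [x [runE Sx stopsT outE [Tle costE]]]]]]] :=
  sfw_run i0 spP bsh trP m0 e0.
exists fuel, T, cost, m, x; split=> //.
have h_le := block_size_depth R n d0.
case: ifP costE => [_ cost_le | stop1]; last first.
  apply: cost_bound h_le => //.
  move: stop1; rewrite l2norm_le // => /negbT; rewrite -ltNge -expr2 => lt_e.
  by apply: ltW; apply: lt_le_trans lt_e (dot_unitv_le2 trP i0).
have W0 : 0 <= d%:R ^+ 2 * ln (2 + n%:R / d%:R ^+ 2) / eps ^+ 2 :> R.
  apply: divr_ge0; last by rewrite exprn_ge0 // ltW.
  apply: mulr_ge0; first by rewrite exprn_ge0.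
  by have := le_trans (ler0n R _) h_le; rewrite pmulr_rge0.
rewrite -(ler_nat R) natrM in cost_le; rewrite /time_bound natrM.
move: (_ / eps ^+ 2) W0 => W W0; move: (n%:R : R) cost_le (ler0n R n) => N.
lra.
Qed.
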